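(* Let $N,n\ge 0$ be integers. Let $S_N(n)$ be the number of partitions $\pi=(\lambda_1,\lambda_2,\dots)$ into distinct parts with $\mathcal{O}(\pi)=n$ and $\lambda_1\le N$. Let $\Gamma_N(n)$ be the number of partitions of $n$ whose largest hook length is $\le N$. Then $S_N(n)=\Gamma_N(n)$.
   Context: A partition is a finite non-increasing sequence of positive integers; the empty sequence is the unique partition of $0$. $\mathcal{O}(\pi)=\lambda_1+\lambda_3+\lambda_5+\cdots$. The hook length of a box in the Ferrers diagram is one plus the number of boxes directly to its right plus the number directly below it; the largest hook length of a nonempty partition equals (number of parts) + (largest part) $-1$, and is $0$ for the empty partition. *)

(* Defs.v *)
From mathcomp Require Import all_boot finmap.
From mathcomp Require Import boolp classical_sets cardinality.

Set Implicit Arguments.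
Unset Strict Implicit.
Unset Printing Implicit Defensive.

Local Open Scope classical_set_scope.

Definition is_partition (s : seq nat) : bool :=
  sorted geq s && all (fun p => 0 < p) s.

(* lambda_1 + lambda_3 + ...: parts are 0-indexed here, so these are the
   entries at even positions *)
Definition odd_indexed_sum (s : seq nat) : nat :=
  \sum_(i < size s | ~~ odd i) nth 0 s i.

(* (i, j) is the 0-indexed box in row i and column j of the Ferrers diagram,
   meaningful when j < nth 0 s i; the last two summands are its arm and leg *)
Definition hook_length (s : seq nat) (i j : nat) : nat :=
  1 + (nth 0 s i - j.+1) + count (fun p => j < p) (drop i.+1 s).

Definition largest_hook (s : seq nat) : nat :=
  \max_(i < size s) \max_(j < nth 0 s i) hook_length s i j.

(* head 0 s is lambda_1, read as 0 for the empty partition *)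
Definition S_set (N n : nat) : set (seq nat) :=
  [set s | [/\ is_partition s, uniq s, odd_indexed_sum s = n & head 0 s <= N]].

Definition Gamma_set (N n : nat) : set (seq nat) :=
  [set s | [/\ is_partition s, sumn s = n & largest_hook s <= N]].

(* fset_set is only meaningful on finite sets: see finite_S_set and
   finite_Gamma_set below *)
Definition S_count (N n : nat) : nat := #|` fset_set (S_set N n)|%fset.

Definition Gamma_count (N n : nat) : nat := #|` fset_set (Gamma_set N n)|%fset.

Lemma finite_bounded_seq (m : nat) :
  finite_set [set s : seq nat | size s <= m /\ all (fun p => p <= m) s].
Proof.
apply: (@sub_finite_set _ _
  ((fun b : m.-bseq 'I_m.+1 => map val b) @` [set: m.-bseq 'I_m.+1])).
  move=> s /= [ss /allP sm].
  have sz : size (map (@inord m) s) <= m by rewrite size_map.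
  exists (Bseq sz) => //=; rewrite -map_comp -[RHS]map_id.
  by apply/eq_in_map => x /sm /= xm; rewrite inordK.
exact/finite_image/finite_finset.
Qed.

Lemma finite_S_set (N n : nat) : finite_set (S_set N n).
Proof.
apply: sub_finite_set (finite_bounded_seq N) => s [/andP[srt pos] us _ hN].
have le : all (fun p => p <= N) s.
  case: s srt hN {pos us} => //= x s srt xN; rewrite xN /=.
  apply/allP => y ys; apply: leq_trans xN.
  have gt : transitive geq by move=> a b c /= ab bc; apply: leq_trans bc ab.
  by move/(order_path_min gt)/allP: srt => /(_ y ys).
split=> //; rewrite -[N in _ <= N](size_iota 1); apply: uniq_leq_size => // x xs.
by rewrite mem_iota (allP pos) //= add1n ltnS (allP le).
Qed.

Lemma finite_Gamma_set (N n : nat) : finite_set (Gamma_set N n).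
Proof.
apply: sub_finite_set (finite_bounded_seq n) => s [/andP[_ pos] <- _].
elim: s pos => //= x s IH /andP[x0 /IH[ss sl]]; split.
  by rewrite -add1n leq_add.
rewrite leq_addr /=; apply: sub_all sl => y ys.
exact: leq_trans ys (leq_addl _ _).
Qed.

(* Main.v *)
From mathcomp Require Import all_boot finmap zify.
From mathcomp Require Import boolp classical_sets cardinality.
Require Import Defs.

Set Implicit Arguments.
Unset Strict Implicit.
Unset Printing Implicit Defensive.

(** Let [a_1 > a_2 > ... > a_k] be the hook lengths of the diagonal boxes of a
    partition of [n], so that [n = a_1 + ... + a_k] and [a_1] is the largest
    hook length.  In Frobenius coordinates [a_i = alpha_i + beta_i + 1], where
    [alpha] and [beta] are strictly decreasing.  Hence, when the [a_i] are
    given, the numbers [b_i = a_(i+1) + alpha_i - alpha_(i+1)] (and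
    [b_k = alpha_k]) can be chosen freely subject to [a_i > b_i > a_(i+1)] (and
    [a_k > b_k >= 0]), which says exactly that [a_1, b_1, a_2, b_2, ...] is a
    partition into distinct parts. *)

(** * Partitions and their largest hook *)

Lemma geq_trans : transitive geq.
Proof. by move=> y x z /= xy yz; apply: leq_trans yz xy. Qed.

Lemma is_partition_cons x s :
  is_partition (x :: s) = [&& 0 < x, all (geq x) s & is_partition s].
Proof.
rewrite /is_partition !(sorted_pairwise geq_trans) /=.
by case: (0 < x); case: (all _ s); rewrite /= ?andbF.
Qed.

Lemma is_partition_uniq s :
  is_partition s && uniq s = sorted gtn s && all (leq 1) s.
Proof.
rewrite /is_partition gtn_sorted_uniq_geq.
by case: (sorted geq s); case: (uniq s); rewrite /= ?andbT ?andbF.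
Qed.

(** The corner box attains the maximum: no row is longer than [x], and no leg exceeds [size t]. *)
Lemma largest_hook_cons x t :
  is_partition (x :: t) -> largest_hook (x :: t) = x + size t.
Proof.
rewrite is_partition_cons => /and3P[x0 /allP xt /andP[_ pos]].
apply/eqP; rewrite eqn_leq; apply/andP; split.
  apply/bigmax_leqP => i _; apply/bigmax_leqP => j _.
  have le_x : nth 0 (x :: t) i <= x.
    by case: i {j} => [[|i] lti] //=; apply/xt/mem_nth.
  have := count_size (fun p => j < p) (drop i.+1 (x :: t)).
  rewrite size_drop /= /hook_length /=; case: j => j /=.
  by move: (nth _ _ _) (count _ _) le_x => y c; lia.
rewrite /largest_hook big_ord_recl; apply: leq_trans (leq_maxl _ _) => /=.
apply: leq_trans (leq_bigmax (Ordinal x0)).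
rewrite /hook_length /= drop0.
by move: pos; rewrite all_count => /eqP ->; lia.
Qed.

Lemma odd_indexed_sum_cons2 a b s :
  odd_indexed_sum (a :: b :: s) = a + odd_indexed_sum s.
Proof.
rewrite /odd_indexed_sum big_mkcond /= 2!big_ord_recl /= add0n -big_mkcond /=.
congr (_ + _); apply: eq_big => [i|i _] //=.
by rewrite negbK.
Qed.

(** * Adding and removing the corner hook *)

(* Adds to the diagram [t] a new first row and first column, with corner hook
   length [a]; [b] prescribes the length of the row as [b.+1 - size t]. *)
Definition add_hook (a b : nat) (t : seq nat) : seq nat :=
  let x := b.+1 - size t in
  x :: map succn t ++ nseq (a - x - size t) 1.

(* [s] is read as [a_1, b_1, a_2, b_2, ...], with [b_k = 0] when its size is
   odd. *)
Fixpoint diagonal_hooks (s : seq nat) : seq nat :=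
  if s is a :: s1 then
    if s1 is b :: s2 then add_hook a b (diagonal_hooks s2)
    else add_hook a 0 [::]
  else [::].

(** Rows of length 1 lie wholly in the first column; filtering them out before decrementing avoids
    zero parts. *)
Definition remove_hook (t : seq nat) : seq nat :=
  map predn (filter (leq 2) (behead t)).

Lemma size_add_hook a b t :
  size t <= b < a -> size (add_hook a b t) = a + size t - b.
Proof. by rewrite /= size_cat size_map size_nseq; lia. Qed.

Lemma add_hookK a b t : all (leq 1) t -> remove_hook (add_hook a b t) = t.
Proof.
move=> pos; rewrite /remove_hook /= filter_cat map_cat.
rewrite (_ : filter _ (nseq _ _) = [::]) ?cats0; last first.
  by rewrite filter_nseq.
rewrite (all_filterP _) ?all_map // -map_comp -[RHS]map_id.
exact: eq_map.
Qed.

(** [remove_hook] recovers [t]; the first row then determines [b], and the number of rows determines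
    [a]. *)
Lemma add_hook_inj a b t a' b' t' :
  all (leq 1) t -> all (leq 1) t' -> size t <= b < a -> size t' <= b' < a' ->
  add_hook a b t = add_hook a' b' t' -> [/\ a = a', b = b' & t = t'].
Proof.
move=> pos pos' ba ba' E.
have tt' : t = t' by rewrite -(add_hookK a b pos) E add_hookK.
have := congr1 size E; rewrite !size_add_hook // => sE.
have := congr1 (head 0) E; rewrite /= -tt' in sE ba' * => hE.
by split=> //; lia.
Qed.

(** The bound on [b] says that the new row, of length [b.+1 - size t], is longer than the first row
    of [t], which itself grows by one box. *)
Lemma add_hook_partition a b t :
  is_partition t -> size t + head 0 t <= b -> is_partition (add_hook a b t).
Proof.
move=> pt le_b; rewrite is_partition_cons subn_gt0 ltnS.
apply/and3P; split; first lia.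
  rewrite all_cat all_map all_nseq; apply/andP; split; last first.
    by apply/orP; right => /=; lia.
  case: t pt le_b => // x t; rewrite is_partition_cons /= => /and3P[_ xt _] le_b.
  apply/andP; split; first lia.
  by apply: sub_all xt => y /=; lia.
case/andP: pt => srt pos.
rewrite /is_partition all_cat all_map all_nseq orbT andbT.
rewrite (sorted_pairwise geq_trans) pairwise_cat pairwise_map.
move: srt; rewrite (sorted_pairwise geq_trans) => srt.
apply/andP; split; last exact/allP.
apply/and3P; split.
- by apply/allrelP => y z /mapP[y' _ ->] /nseqP[-> _].
- exact: srt.
- by elim: (_ - _ - _) => //= k ->; rewrite all_nseq orbT.
Qed.

Lemma sumn_add_hook a b t :
  size t <= b < a -> sumn (add_hook a b t) = a + sumn t.
Proof.
move=> ba; rewrite /= sumn_cat sumn_nseq.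
have -> : sumn (map succn t) = sumn t + size t.
  by elim: t {ba} => //= x t ->; lia.
lia.
Qed.

Lemma remove_hook_partition t : is_partition t -> is_partition (remove_hook t).
Proof.
case: t => // x t; rewrite is_partition_cons => /and3P[_ _].
rewrite /remove_hook /=; elim: t => //= y t IH.
rewrite is_partition_cons => /and3P[_ yt /IH pt].
case: ifP => //= y1; rewrite is_partition_cons pt andbT.
apply/andP; split; first lia.
apply/allP => w /mapP[z]; rewrite mem_filter => /andP[_ /(allP yt)] /= zy ->.
lia.
Qed.

Lemma size_remove_hook t : size (remove_hook t) <= (size t).-1.
Proof. by rewrite size_map size_filter -size_behead count_size. Qed.

Lemma remove_hookK x t : is_partition (x :: t) ->
  add_hook (x + size t) (x.-1 + size (remove_hook (x :: t)))
    (remove_hook (x :: t)) = x :: t.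
Proof.
move=> pxt; have := size_remove_hook (x :: t) => /= sz.
move: (pxt); rewrite is_partition_cons /add_hook => /and3P[x0 _ pt].
have -> : (x.-1 + size (remove_hook (x :: t))).+1
          - size (remove_hook (x :: t)) = x by lia.
rewrite addKn; congr cons; rewrite /remove_hook /= {pxt x x0 sz}.
elim: t pt => // y t IH; rewrite is_partition_cons => /and3P[y0 yt pt] /=; have E := IH pt.
case: ifP => y1 /=; first by rewrite subSS E prednK.
(* Once a row has length 1, so do all later ones: they belong to the removed column. *)
have t1 : t = nseq (size t) 1.
  apply/all_pred1P/allP => z zt; have := allP yt z zt.
  case/andP: pt => _ /allP /(_ z zt) => /=; lia.
by rewrite t1 filter_nseq /= size_nseq; congr cons; lia.
Qed.

(** * The bijection from strict partitions to partitions *)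

Definition strict_partition (s : seq nat) : bool := sorted gtn s && all (leq 1) s.

Lemma strict_partition_cons a s :
  strict_partition (a :: s) = (head 0 s < a) && strict_partition s.
Proof.
rewrite /strict_partition; case: s => [|b s] /=; first by rewrite !andbT.
case: (ltnP b a) => //= ba; case: (posnP b) => [->|b0] /=.
  by rewrite !andbF.
by rewrite (leq_ltn_trans _ ba).
Qed.

Lemma seq_two_step_ind (T : Type) (P : seq T -> Prop) :
  P [::] -> (forall a, P [:: a]) -> (forall a b s, P s -> P (a :: b :: s)) ->
  forall s, P s.
Proof.
move=> P0 P1 P2 s; suff [] : P s /\ forall a, P (a :: s) by [].
by elim: s => [|b s [Ps Pas]]; split=> // a; apply: P2.
Qed.

Lemma diagonal_hooks_spec s : strict_partition s ->
  [/\ is_partition (diagonal_hooks s),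
      size (diagonal_hooks s) + head 0 (diagonal_hooks s)
        = head 0 s + (s != [::]) &
      sumn (diagonal_hooks s) = odd_indexed_sum s].
Proof.
elim/seq_two_step_ind: s => [|a|a b s IH].
- by rewrite /odd_indexed_sum big_ord0.
- rewrite strict_partition_cons => /andP[a0 _]; split.
  + exact: add_hook_partition.
  + by rewrite size_add_hook //=; lia.
  + by rewrite sumn_add_hook // /odd_indexed_sum big_mkcond big_ord1 /= addn0.
rewrite !strict_partition_cons => /and3P[ba sb /IH[pt ht st]]; rewrite /= in ba.
(* For nonempty [s] the left side is one more than the corner hook length [head 0 s], so the bound
   amounts to [head 0 s < b]. *)
have le_b : size (diagonal_hooks s) + head 0 (diagonal_hooks s) <= b.
  by rewrite ht; case: (s) sb => //= *; lia.
rewrite (_ : diagonal_hooks _ = add_hook a b (diagonal_hooks s)) //; split.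
- exact: add_hook_partition.
- by rewrite size_add_hook /=; lia.
- by rewrite sumn_add_hook ?odd_indexed_sum_cons2 ?st //; lia.
Qed.

(** Treats both parities of the size at once: for empty [s], [head 0 s] supplies the missing [b] as
    0. The bounds are those required by [add_hook_inj]. *)
Lemma diagonal_hooks_cons a s : strict_partition (a :: s) ->
  exists t, [/\ t = diagonal_hooks (behead s), all (leq 1) t,
    size t <= head 0 s < a & diagonal_hooks (a :: s) = add_hook a (head 0 s) t].
Proof.
rewrite strict_partition_cons => /andP[sa].
case: s sa => [|b s] /= sa; first by exists [::].
rewrite strict_partition_cons => /andP[sb /diagonal_hooks_spec[pt ht _]].
exists (diagonal_hooks s); split=> //; first by case/andP: pt.
by move: ht; case: (s) sb => //= *; lia.
Qed.

Lemma strict_partition_behead s :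
  strict_partition s -> strict_partition (behead s).
Proof. by case: s => // a s; rewrite strict_partition_cons => /andP[]. Qed.

Lemma diagonal_hooks_inj :
  {in strict_partition &, injective diagonal_hooks}.
Proof.
move=> s s'; rewrite !unfold_in.
have [m] := ubnP (size s); elim: m s s' => // m IH [|a s] [|a' s'] //.
- by move=> _ _ /diagonal_hooks_cons[t [_ _ _ ->]].
- by move=> _ /diagonal_hooks_cons[t [_ _ _ ->]].
move=> le_m ps ps'.
have [t [Et pos ba ->]] := diagonal_hooks_cons ps.
have [t' [Et' pos' ba' ->]] := diagonal_hooks_cons ps'.
case/add_hook_inj => // -> hE tE; congr cons.
have {}ps := strict_partition_behead ps.
have {}ps' := strict_partition_behead ps'.
have bE : behead s = behead s'.
  apply: IH; rewrite -?Et -?Et' //; last 2 first.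
  - exact: strict_partition_behead ps.
  - exact: strict_partition_behead ps'.
  by rewrite size_behead; move: le_m => /=; lia.
(* Only a missing [b] and a part [b = 0] could be confused, and parts are positive. *)
case: s s' ps ps' hE bE {le_m ba ba' Et Et'} => [|b s] [|b' s'] //=.
- by move=> _ /andP[_ /= /andP[b0 _]] E; lia.
- by move=> /andP[_ /= /andP[b0 _]] _ E; lia.
- by move=> _ _ -> ->.
Qed.

Lemma diagonal_hooks_surj t : is_partition t ->
  exists2 s, strict_partition s & diagonal_hooks s = t.
Proof.
have [m] := ubnP (size t); elim: m t => // m IH [|x t] le_m pt.
  by exists [::].
have sz := size_remove_hook (x :: t).
have [|s ps Es] := IH (remove_hook (x :: t)) _ (remove_hook_partition pt).
  by move: le_m sz => /=; lia.
have [_ hs _] := diagonal_hooks_spec ps.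
move: (pt); rewrite is_partition_cons => /and3P[x0 /allP xt _].
(* With [hs], this makes the new entry [b] exceed [head 0 s] when [s] is nonempty. *)
have hx : head 0 (remove_hook (x :: t)) < x.
  case E : (remove_hook (x :: t)) => [//|y u] /=.
  have : y \in remove_hook (x :: t) by rewrite E mem_head.
  by case/mapP => z; rewrite mem_filter => /andP[z1 /xt] /=; lia.
have := remove_hookK pt.
(* If [b = 0], the diagram is a single column, encoded by one entry since 0 is not a part. *)
case: (posnP (x.-1 + size (remove_hook (x :: t)))) => [b0|b0] E.
  exists [:: x + size t]; first by rewrite /strict_partition /= andbT; lia.
  rewrite -E b0 /=; suff -> : remove_hook (x :: t) = [::] by [].
  by apply/size0nil; lia.
exists [:: x + size t, x.-1 + size (remove_hook (x :: t)) & s].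
  rewrite !strict_partition_cons ps andbT /=.
  move: hs; rewrite Es; case: (s) => /= *; move: sz => /=; lia.
by rewrite -[RHS]E -Es.
Qed.

Lemma largest_hookE s :
  is_partition s -> (size s + head 0 s).-1 = largest_hook s.
Proof.
case: s => [|x t pt]; first by rewrite /largest_hook big_ord0.
by rewrite largest_hook_cons //=; lia.
Qed.

(** * Transfer to the two counted sets *)

Local Open Scope classical_set_scope.

Lemma diagonal_hooks_image N n :
  diagonal_hooks @` S_set N n = Gamma_set N n.
Proof.
have hookE s : strict_partition s ->
    largest_hook (diagonal_hooks s) = head 0 s.
  move=> /diagonal_hooks_spec[/largest_hookE <- -> _].
  by case: s => //= *; lia.
apply/seteqP; split=> [_ [s [ps us <- hN] <-]|t [pt <- hN]].
  have {}ps : strict_partition s.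
    by rewrite /strict_partition -is_partition_uniq ps us.
  have [pt _ st] := diagonal_hooks_spec ps.
  by split=> //; rewrite hookE.
have [s ps Es] := diagonal_hooks_surj pt; exists s => //.
have [_ _ st] := diagonal_hooks_spec ps.
move: (ps); rewrite /strict_partition -is_partition_uniq => /andP[ips us].
by split; rewrite -?hookE -?st ?Es.
Qed.

Theorem theorem3p3 (N n : nat) : S_count N n = Gamma_count N n.
Proof.
rewrite /S_count /Gamma_count -diagonal_hooks_image.
rewrite fset_set_image; last exact: finite_S_set.
rewrite card_in_imfset // => s s'.
rewrite !in_fset_set; [|exact: finite_S_set..].
rewrite !inE => -[ps us _ _] [ps' us' _ _].
by apply: diagonal_hooks_inj;
  rewrite unfold_in /strict_partition -is_partition_uniq ?ps ?us ?ps' ?us'.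
Qed.
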